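(* Let $m$ be a positive integer and $k$ a nonnegative integer. Let $T_{m-1}(x)=\sum_{n=0}^{m-1}\frac{x^n}{n!}$ be the $(m-1)$-th order Taylor polynomial of $e^x$ at $x=0$, and let $g_{k,m}(x)=\sum_{n=0}^{\infty} r_m(n,k)\frac{x^n}{n!}$ be the exponential generating function of the sequence $\{r_m(n,k)\}_{n=0}^{\infty}$. Then $$g_{k,m}(x)=\frac{\left[e^x-T_{m-1}(x)\right]^k}{\left[2-T_{m-1}(x)\right]^{k+1}}.$$
   Context: An outcome of a race among $n$ distinct participants is an ordered partition of an $n$-element set, i.e. a finite sequence of pairwise disjoint nonempty subsets (blocks) whose union is the whole set. A tie of size $s$ is a block with exactly $s$ elements (so $s=1$ is allowed). For positive integers $n, m$ and a nonnegative integer $k$, $r_m(n,k)$ denotes the number of outcomes of a race among $n$ distinct participants that contain exactly $k$ ties of size at least $m$, i.e. the number of ordered partitions of an $n$-element set having exactly $k$ blocks of cardinality at least $m$ (the other blocks having cardinality less than $m$). Conventions: $r_m(0,0)=1$ and $r_m(0,k)=0$ for $k\geqslant 1$. The identity is an identity of formal power series in $x$ over $\mathbb{Q}$, where $e^x=\sum_{n\geqslant 0}x^n/n!$ and $2-T_{m-1}(x)$ is invertible because its constant term is $1$; the zeroth power of a series is $1$. *)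

(* Defs.v *)
From HB Require Import structures.
From mathcomp Require Import all_boot all_order all_algebra.
From mathcomp Require Import boolp.

Set Implicit Arguments.
Unset Strict Implicit.
Unset Printing Implicit Defensive.

Import GRing.Theory.
Local Open Scope ring_scope.

(* Formal power series in one variable over R, as coefficient sequences.  They
   are wrapped in a record so that the product is the Cauchy product and not the
   pointwise one that mathcomp-classical puts on function types. *)
Record fps (R : Type) := Fps { fps_coef : nat -> R }.

HB.instance Definition _ (R : Type) := gen_eqMixin (fps R).
HB.instance Definition _ (R : Type) := gen_choiceMixin (fps R).

Lemma fpsP (R : Type) (f g : fps R) : (forall n, fps_coef f n = fps_coef g n) -> f = g.
Proof. by case: f g => [f] [g] /= fg; congr Fps; apply/funext. Qed.

Section FpsRing.
Variable R : comUnitRingType.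
Implicit Types f g h : fps R.

Definition fps_zero : fps R := Fps (fun=> 0).
Definition fps_opp f : fps R := Fps (fun n => - fps_coef f n).
Definition fps_add f g : fps R := Fps (fun n => fps_coef f n + fps_coef g n).
Definition fps_one : fps R := Fps (fun n => (n == 0%N)%:R).
Definition fps_mul f g : fps R :=
  Fps (fun n => \sum_(i < n.+1) fps_coef f i * fps_coef g (n - i)%N).

Lemma fps_addA : associative fps_add.
Proof. by move=> f g h; apply: fpsP => n /=; rewrite addrA. Qed.
Lemma fps_addC : commutative fps_add.
Proof. by move=> f g; apply: fpsP => n /=; rewrite addrC. Qed.
Lemma fps_add0 : left_id fps_zero fps_add.
Proof. by move=> f; apply: fpsP => n /=; rewrite add0r. Qed.
Lemma fps_addN : left_inverse fps_zero fps_opp fps_add.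
Proof. by move=> f; apply: fpsP => n /=; rewrite addNr. Qed.

HB.instance Definition _ :=
  GRing.isZmodule.Build (fps R) fps_addA fps_addC fps_add0 fps_addN.

Definition fps_trunc N f : {poly R} := \poly_(i < N) fps_coef f i.

Lemma fps_coef_mul N f g n : (n < N)%N ->
  fps_coef (fps_mul f g) n = (fps_trunc N f * fps_trunc N g)`_n.
Proof.
move=> nN; rewrite coefM /=; apply: eq_bigr => i _; rewrite !coef_poly.
have iN : (i < N)%N by apply: leq_ltn_trans nN; rewrite -ltnS.
by rewrite iN (leq_ltn_trans (leq_subr _ _) nN).
Qed.

Lemma fps_mulA : associative fps_mul.
Proof.
move=> f g h; apply: fpsP => n.
transitivity (fps_trunc n.+1 f * (fps_trunc n.+1 g * fps_trunc n.+1 h))`_n.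
  rewrite coefM; apply: eq_bigr => i _.
  by rewrite coef_poly ltn_ord -fps_coef_mul // ltnS leq_subr.
rewrite mulrA coefM; apply: eq_bigr => i _.
by rewrite [in RHS]/= coef_poly ltnS leq_subr -fps_coef_mul.
Qed.

Lemma fps_mulC : commutative fps_mul.
Proof.
by move=> f g; apply: fpsP => n; rewrite !(@fps_coef_mul n.+1) // mulrC.
Qed.

Lemma fps_mul1 : left_id fps_one fps_mul.
Proof.
move=> f; apply: fpsP => n /=; rewrite big_ord_recl /= mul1r subn0.
by rewrite big1 ?addr0 // => i _; rewrite mul0r.
Qed.

Lemma fps_mulDl : left_distributive fps_mul +%R.
Proof.
move=> f g h; apply: fpsP => n /=; rewrite -big_split /=.
by apply: eq_bigr => i _; rewrite mulrDl.
Qed.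

Lemma fps_one_neq0 : fps_one != 0.
Proof.
apply/eqP => /(congr1 (fun f => fps_coef f 0%N)) /= /eqP.
by rewrite (negPf (oner_neq0 R)).
Qed.

HB.instance Definition _ := GRing.Zmodule_isComNzRing.Build (fps R)
  fps_mulA fps_mulC fps_mul1 fps_mulDl fps_one_neq0.

(* The coefficients 0, ..., n of the inverse, computed recursively from
   f_0 g_(n+1) = - \sum_(i <= n) f_(i+1) g_(n-i). *)
Fixpoint fps_inv_seq f n : seq R :=
  if n is n'.+1 then
    let s := fps_inv_seq f n' in
    rcons s (- ((fps_coef f 0)^-1 *
                \sum_(i < n'.+1) fps_coef f i.+1 * s`_(n' - i)))
  else [:: (fps_coef f 0)^-1].

Definition fps_unit : {pred fps R} := [pred f | fps_coef f 0 \is a GRing.unit].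

(* As for every MathComp ring with units, the inverse of a non-unit is itself. *)
Definition fps_inv f : fps R :=
  if f \in fps_unit then Fps (fun n => (fps_inv_seq f n)`_n) else f.

Lemma size_fps_inv_seq f n : size (fps_inv_seq f n) = n.+1.
Proof. by elim: n => //= n IHn; rewrite size_rcons IHn. Qed.

Lemma nth_fps_inv_seq f n i : (i <= n)%N ->
  (fps_inv_seq f n)`_i = (fps_inv_seq f i)`_i.
Proof.
elim: n => [|n IHn]; first by rewrite leqn0 => /eqP ->.
rewrite leq_eqVlt => /predU1P[-> //|]; rewrite ltnS => le_in.
by rewrite /= nth_rcons size_fps_inv_seq ltnS le_in IHn.
Qed.

Lemma fps_mulVx : {in fps_unit, left_inverse 1 fps_inv *%R}.
Proof.
move=> f fU; rewrite mulrC; apply: fpsP => n.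
rewrite /= /fps_inv fU; move: fU; rewrite inE => fU.
case: n => [|n]; first by rewrite big_ord1 /= mulrV.
rewrite big_ord_recl subn0 /= nth_rcons size_fps_inv_seq ltnn eqxx.
rewrite mulrN mulVKr // addrC; apply/eqP; rewrite subr_eq0; apply/eqP.
by apply: eq_bigr => i _; rewrite /= subSS [in RHS]nth_fps_inv_seq ?leq_subr.
Qed.

Lemma fps_unitPl f g : g * f = 1 -> fps_unit f.
Proof.
move/(congr1 (fun h => fps_coef h 0%N)); rewrite /= big_ord1 /= => gf.
by apply/unitrPr; exists (fps_coef g 0); rewrite mulrC.
Qed.

Lemma fps_invr_out : {in [predC fps_unit], fps_inv =1 id}.
Proof. by move=> f; rewrite inE /= /fps_inv => /negPf ->. Qed.

HB.instance Definition _ := GRing.ComNzRing_hasMulInverse.Build (fps R)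
  fps_mulVx fps_unitPl fps_invr_out.

Definition fps_of_poly (p : {poly R}) : fps R := Fps (fun n => p`_n).

Definition egf (a : nat -> R) : fps R := Fps (fun n => a n / (n`!)%:R).

End FpsRing.

Definition fps_exp : fps rat := Fps (fun n => (n`!)%:R^-1).

Definition exp_taylor (d : nat) : {poly rat} := \poly_(n < d.+1) (n`!)%:R^-1.

Lemma unit_2_sub_exp_taylor (d : nat) :
  (2%:R - fps_of_poly (exp_taylor d) : fps rat) \is a GRing.unit.
Proof. by rewrite /GRing.unit /= /fps_unit inE /= coef_poly /=. Qed.

Definition ordered_partition (T : finType) (s : seq {set T}) : bool :=
  [&& set0 \notin s, pairwise (fun A B : {set T} => [disjoint A & B]) s
    & \bigcup_(B <- s) B == [set: T]].

Lemma size_ordered_partition (T : finType) (s : seq {set T}) :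
  ordered_partition s -> (size s <= #|T|)%N.
Proof.
case/and3P=> s0 sd _.
pose F (B : {set T}) := #|B|.
have [Es le_s] : #|(\bigcup_(B <- s) B : {set T})| = (\sum_(B <- s) F B)%N /\
    (size s <= \sum_(B <- s) F B)%N; last first.
  by rewrite (leq_trans le_s) // -Es max_card.
elim: s s0 sd => [|A s IHs]; first by rewrite !big_nil cards0.
rewrite inE negb_or eq_sym pairwise_cons => /andP[A0 s0] /andP[/allP dA sd].
have [IH1 IH2] := IHs s0 sd; rewrite !big_cons /= -IH1; split; last first.
  by rewrite -add1n leq_add ?card_gt0 // IH1.
apply/eqP; rewrite leq_card_setU -setI_eq0 big_distrr /= big1_seq // => B.
by case/andP=> _ /dA; rewrite -setI_eq0 => /eqP.
Qed.

(* Sequences of length at most n form a finite type and, by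
   size_ordered_partition, contain all ordered partitions of 'I_n. *)
Definition r_ (m n k : nat) : nat :=
  #|[set s : n.-bseq {set 'I_n} | ordered_partition s &
      count (fun B : {set 'I_n} => m <= #|B|)%N s == k]|.

Lemma r_0 (m k : nat) : r_ m 0 k = (k == 0)%N.
Proof.
pose e : 0.-bseq {set 'I_0} := nil_bseq 0 _.
have eP s : s = e by apply/val_inj/nilP; rewrite /nilp -leqn0 size_bseq.
have oe : ordered_partition e.
  by rewrite /ordered_partition big_nil; apply/eqP/setP => -[].
rewrite /r_ (_ : finset _ = if k == 0%N then [set e] else set0).
  by case: eqP; rewrite ?cards1 ?cards0.
apply/setP => s; rewrite (eP s) inE oe /= eq_sym.
by case: eqP; rewrite ?inE ?eqxx.
Qed.

(* Main.v *)
Require Import Defs.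
From mathcomp Require Import all_boot all_order all_algebra.

Set Implicit Arguments.
Unset Strict Implicit.
Unset Printing Implicit Defensive.

Import GRing.Theory Num.Theory.
Local Open Scope ring_scope.

(** The proof decomposes an outcome by its first block.  An ordered partition
    of a set [A] is either empty (and then [A] is empty) or a nonempty first
    block [B] included in [A] followed by an ordered partition of [A :\: B].
    There are ['C(n, j)] choices of [B] of size [j], so, for exponential
    generating functions, choosing [B] is multiplication by

      - [S = e^x - T], with [T = T_(m-1)], if [B] is a tie of size at least [m]
        (which leaves one tie less to be found);
      - [P = T - 1] if [B] is smaller (the [-1] removes the empty block).

    The generating functions therefore satisfy
      [g_k = (k == 0) + S g_(k-1) + P g_k], with [g_(-1) = 0].
    The series [F_k = S^k / (2 - T)^(k+1)] solves the same equation, because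
    [1 - P = 2 - T] ([tie_series_rec]).  Since [S] and [P] have no constant term,
    the equation determines its solution coefficient by coefficient; the
    corresponding induction, on a bound for the number of blocks, is
    [count_partition_seqs]. *)

(** * Ordered partitions of a subset, by first block *)

Section PartitionSeqs.
Variable T : finType.
Implicit Types (A B : {set T}) (s : seq {set T}).

Definition ordered_partition_of A s : bool :=
  [&& set0 \notin s, pairwise (fun B C : {set T} => [disjoint B & C]) s
    & \bigcup_(B <- s) B == A].

Lemma ordered_partition_of_nil A : ordered_partition_of A [::] = (A == set0).
Proof. by rewrite /ordered_partition_of big_nil eq_sym. Qed.

Lemma disjoint_bigcup_seq B s :
  [disjoint B & \bigcup_(C <- s) C] = all (fun C : {set T} => [disjoint B & C]) s.
Proof.
elim: s => [|C s IHs]; first by rewrite big_nil -setI_eq0 setI0 eqxx.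
by rewrite big_cons /= -IHs -!setI_eq0 setIUr setU_eq0.
Qed.

(** Disjointness of [B] from the later blocks is the same as disjointness from
    their union [U]; together with [B :|: U = A] it says that [B] is included in
    [A] and that the later blocks cover exactly [A :\: B]. *)
Lemma ordered_partition_of_cons A B s :
  ordered_partition_of A (B :: s) =
  [&& B != set0, B \subset A & ordered_partition_of (A :\: B) s].
Proof.
rewrite /ordered_partition_of inE negb_or eq_sym pairwise_cons big_cons.
rewrite -disjoint_bigcup_seq; set U := \bigcup_(C <- s) C.
have split_union : [disjoint B & U] && (B :|: U == A) =
    (B \subset A) && (U == A :\: B).
  apply/andP/andP=> [[dBU /eqP<-]|[BA /eqP->]].
    rewrite subsetUl setDUl setDv set0U; split=> //; apply/eqP/esym/setDidPl.
    by rewrite disjoint_sym.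
  by rewrite -{3}(setID A B) (setIidPr BA) eqxx -setI_eq0 setIDA setDIl setDv set0I eqxx.
transitivity [&& B != set0, set0 \notin s,
    pairwise (fun C D : {set T} => [disjoint C & D]) s,
    [disjoint B & U] & B :|: U == A].
  by rewrite -!andbA; do 2 congr andb; rewrite andbCA.
rewrite split_union; congr andb; rewrite [RHS]andbCA; congr andb.
by rewrite andbCA.
Qed.

Definition first_blocks A : seq {set T} :=
  enum [set B in powerset A | B != set0].

(** The bound [N] on the number of blocks makes the recursion structural, and
    no ordered partition of [A] is lost as soon as [#|A| <= N]. *)
Fixpoint partition_seqs N A : seq (seq {set T}) :=
  nseq (A == set0) [::] ++
  if N is N'.+1 then
    [seq B :: s | B <- first_blocks A, s <- partition_seqs N' (A :\: B)]
  else [::].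

Lemma mem_partition_seqs N A s :
  (s \in partition_seqs N A) = ordered_partition_of A s && (size s <= N)%N.
Proof.
elim: N A s => [|N IHN] A [|B s] /=; rewrite mem_cat mem_nseq.
- by rewrite ordered_partition_of_nil eqxx !andbT lt0b orbF.
- by rewrite !andbF.
- rewrite ordered_partition_of_nil eqxx !andbT lt0b.
  by case: (A == set0) => //=; apply/allpairsPdep => -[? [? []]].
rewrite andbF /= ordered_partition_of_cons ltnS -2!andbA -IHN.
apply/allpairsPdep/and3P=> [[C [t [Cin tin [-> ->]]]]|[B0 BA sin]].
  by move: Cin; rewrite mem_enum !inE => /andP[].
by exists B, s; split=> //; rewrite mem_enum !inE BA.
Qed.

Lemma partition_seqs_uniq N A : uniq (partition_seqs N A).
Proof.
elim: N A => [|N IHN] A /=; first by rewrite cats0; case: eqP.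
rewrite cat_uniq; apply/and3P; split; first by case: eqP.
  by apply/hasPn => ? /allpairsPdep[B [s [_ _ ->]]]; rewrite mem_nseq andbF.
apply: allpairs_uniq_dep => [|B _|]; [exact: enum_uniq | exact: IHN |].
by move=> [B s] [C t] _ _ /= [-> ->].
Qed.

Lemma sum_first_blocks A (f : nat -> rat) :
  \sum_(B <- first_blocks A) f #|B| =
  \sum_(j < #|A|.+1 | (0 < j)%N) 'C(#|A|, j)%:R * f j.
Proof.
rewrite /first_blocks big_enum /=.
rewrite (partition_big (fun B : {set T} => inord #|B| : 'I_#|A|.+1)
           (fun j : 'I__ => 0 < j)%N) => [|B]; last first.
  rewrite !inE => /andP[BA B0].
  by rewrite inordK ?card_gt0 // ltnS subset_leq_card.
apply: eq_bigr => j j0; rewrite -cards_draws mulr_natl.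
rewrite (eq_bigr (fun=> f j)) => [|B /andP[]]; last first.
  rewrite !inE => /andP[BA _] /eqP <-.
  by rewrite inordK // ltnS subset_leq_card.
rewrite sumr_const; congr (_ *+ _); apply: eq_card => B.
rewrite unfold_in !inE; case BA: (B \subset A) => //=.
have le_B : (#|B| < #|A|.+1)%N by rewrite ltnS subset_leq_card.
have -> : (inord #|B| == j) = (#|B| == j :> nat).
  by rewrite -(inj_eq val_inj) /= inordK.
rewrite andbC.
by case: eqP => //= Bj; rewrite -card_gt0 Bj.
Qed.

End PartitionSeqs.

Definition nb_ties (T : finType) m (s : seq {set T}) : nat :=
  count (fun B : {set T} => m <= #|B|)%N s.

Lemma r_partition_seqs m n k :
  r_ m n k = count (fun s => nb_ties m s == k) (partition_seqs n [set: 'I_n]).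
Proof.
rewrite /r_ cardE -(size_map val) -size_filter; apply: perm_size.
apply: uniq_perm => [||s].
- by rewrite (map_inj_uniq val_inj) enum_uniq.
- exact/filter_uniq/partition_seqs_uniq.
rewrite mem_filter mem_partition_seqs; apply/mapP/and3P.
  move=> [b]; rewrite mem_enum inE => /andP[ob nb] ->.
  by split=> //; exact: size_bseq.
move=> [nb ob le_s]; exists (Bseq le_s) => //.
by rewrite mem_enum inE; apply/andP.
Qed.

(** * The series on the right-hand side *)

Section TieSeries.
Variables (m : nat) (hm : (0 < m)%N).
Implicit Types (j k n N : nat).

Let T : fps rat := fps_of_poly (exp_taylor m.-1).

Definition tie_series k : fps rat := (fps_exp - T) ^+ k / (2%:R - T) ^+ k.+1.

(** The convention that the series of index [-1] is [0] makes [tie_series_rec]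
    a single equation for all [k]. *)
Definition tie_series_pred k : fps rat := if k is k'.+1 then tie_series k' else 0.

(** Moving the last term to the left multiplies [tie_series k] by
    [1 - (T - 1) = 2 - T], which cancels one factor of its denominator. *)
Lemma tie_series_rec k :
  tie_series k =
  (k == 0%N)%:R + (fps_exp - T) * tie_series_pred k + (T - 1) * tie_series k.
Proof.
have U := unit_2_sub_exp_taylor m.-1; rewrite -/T in U.
have step j : (2%:R - T) * tie_series j = (fps_exp - T) ^+ j / (2%:R - T) ^+ j.
  by rewrite /tie_series exprS invrM ?unitrX // mulrC -mulrA mulrVK.
apply/eqP; rewrite -subr_eq -[X in X - _]mul1r -mulrBl opprB addrA step.
case: k => [|k]; first by rewrite divr1 mulr0 addr0.
by rewrite /= /tie_series exprS mulrA add0r.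
Qed.

Lemma coef_exp_sub_taylor j :
  fps_coef (fps_exp - T) j = if (m <= j)%N then (j`!%:R)^-1 else 0.
Proof.
rewrite /= coef_poly prednK // ltnNge.
by case: leqP => _; rewrite ?subr0 ?subrr.
Qed.

Lemma coef_taylor_sub1 j :
  fps_coef (T - 1) j = if (0 < j < m)%N then (j`!%:R)^-1 else 0.
Proof.
rewrite /= coef_poly prednK //.
by case: j => [|j]; rewrite ?hm ?subrr //= subr0.
Qed.

(** The series of the outcomes that may follow a first block of size [j] when
    [k] ties of size at least [m] are wanted in total. *)
Definition tie_series_after j k : fps rat :=
  if (m <= j)%N then tie_series_pred k else tie_series k.

(** [e^x - T] and [T - 1] have disjoint supports, so the two products of
    [tie_series_rec] merge into a single sum over the size [j] of the first
    block, and neither support contains [j = 0]. *)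
Lemma coef_tie_series_rec n k :
  fps_coef (tie_series k) n = ((n == 0%N) && (k == 0%N))%:R +
    \sum_(j < n.+1 | (0 < j)%N)
       (j`!%:R)^-1 * fps_coef (tie_series_after j k) (n - j)%N.
Proof.
rewrite [in LHS]tie_series_rec -addrA.
have -> : ((n == 0%N) && (k == 0%N))%:R = fps_coef ((k == 0%N)%:R : fps rat) n.
  by case: (k == 0%N); rewrite /= ?andbT ?andbF.
congr (_ + _); rewrite [LHS]/= -big_split [RHS]big_mkcond /=.
apply: eq_bigr => j _.
move: (coef_exp_sub_taylor j) (coef_taylor_sub1 j) => /= -> ->.
rewrite /tie_series_after lt0n ltnNge; case: leqP => [mj|jm].
  by rewrite -lt0n (leq_trans hm mj) andbF mul0r addr0.
by rewrite mul0r add0r andbT; case: ifP; rewrite ?mul0r.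
Qed.

(** Induction on [N]: a first block [B] is nonempty, so the rest is a partition
    of a set with at most [N] elements when [A] has at most [N.+1].  The number
    ['C(#|A|, j)] of first blocks [B] of size [j], times the factor
    [#|A :\: B|`!] of the induction hypothesis, is [#|A|`! / j`!]. *)
Lemma count_partition_seqs (I : finType) N (A : {set I}) k : (#|A| <= N)%N ->
  (count (fun s => nb_ties m s == k) (partition_seqs N A))%:R =
  #|A|`!%:R * fps_coef (tie_series k) #|A|.
Proof.
elim: N A k => [|N IHN] A k le_A.
  move: le_A; rewrite leqn0 => A0; rewrite coef_tie_series_rec.
  rewrite /= cats0 count_nseq eq_sym -cards_eq0 (eqP A0) /= fact0 mul1r.
  by rewrite big_mkcond big_ord1 /= addr0 muln1 eq_sym.
rewrite coef_tie_series_rec mulrDr /= count_cat natrD; congr (_ + _).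
  rewrite count_nseq -cards_eq0 [nb_ties _ _]/= [0%N == k]eq_sym -natrM.
  by case: (#|A| =P 0%N) => [->|_]; rewrite ?muln0 // muln1 fact0 mul1n.
rewrite count_flatten sumnE !big_map natr_sum.
pose f j := (#|A| - j)`!%:R * fps_coef (tie_series_after j k) (#|A| - j).
transitivity (\sum_(B <- first_blocks A) f #|B|).
  rewrite big_seq [RHS]big_seq; apply: eq_bigr => B.
  rewrite mem_enum !inE => /andP[BA B0]; rewrite count_map.
  have cD : #|A :\: B| = (#|A| - #|B|)%N by rewrite cardsD (setIidPr BA).
  have le_D : (#|A :\: B| <= N)%N.
    by rewrite cD leq_subLR (leq_trans le_A) // -add1n leq_add2r card_gt0.
  rewrite /f /tie_series_after -cD; case: ifP => mB; last first.
    by rewrite -IHN //; congr _%:R; apply: eq_count => s /=; rewrite mB.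
  (* With [k = 0], a first block of size at least [m] is already one tie too many. *)
  case: k {f} => [|k] /=.
    by rewrite mulr0 (eq_count (a2 := pred0)) ?count_pred0 // => s /=; rewrite mB.
  by rewrite -IHN //; congr _%:R; apply: eq_count => s /=; rewrite mB.
rewrite sum_first_blocks mulr_sumr; apply: eq_bigr => j _.
rewrite /f !mulrA; congr (_ * _).
have le_j : (j <= #|A|)%N by rewrite -ltnS.
rewrite -(bin_fact le_j) !natrM -!mulrA; congr (_ * _).
rewrite mulrCA divff ?mulr1 // pnatr_eq0 -lt0n; exact: fact_gt0.
Qed.

End TieSeries.

Theorem theorem7 (m k : nat) (hm : (0 < m)%N) :
  egf (fun n : nat => (r_ m n k)%:R : rat) =
  (fps_exp - fps_of_poly (exp_taylor m.-1)) ^+ k /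
  (2%:R - fps_of_poly (exp_taylor m.-1)) ^+ k.+1.
Proof.
apply: fpsP => n; rewrite -/(tie_series m k) /= r_partition_seqs.
rewrite count_partition_seqs ?cardsT ?card_ord // mulrC mulKf //.
by rewrite pnatr_eq0 -lt0n fact_gt0.
Qed.
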